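(* For all $\theta\in\Theta$ and all $z\in\mathcal{Z}$, $$F_{IA}(\theta,z)=\bigcap_{z_*\in\mathcal{Z}}T_N^{\perp_*}(\theta,z_* ),$$ where $T_N^{\perp_*}(\theta,z_* )$ denotes the orthogonal complement of $T_N(\theta,z_* )$ in $L^2_0(P_{\theta z_*})$.
   Context: Setting. $\lambda$ is a $\sigma$-finite measure on a measurable space $(\mathcal{X},\mathcal{A})$; $\mathcal{P}^*=\{p(\cdot;\theta,z)=dP_{\theta z}/d\lambda:\theta\in\Theta,\ z\in\mathcal{Z}\}$ is a family of probability densities, $\Theta\subseteq\mathbb{R}^q$ is open, $\mathcal{Z}$ is an arbitrary set, $(\theta,z)\mapsto p(\cdot;\theta,z)$ is a bijection onto $\mathcal{P}^*$, and all densities are strictly positive. $L^2_0(P)$ is the space of $P$-square-integrable functions with $P$-mean zero; $\langle\cdot,\cdot\rangle_{\theta z}$ is the inner product of $L^2(P_{\theta z})$. Nuisance tangent space. For $\theta\in\Theta$ let $\mathcal{P}^*_\theta=\{p(\cdot;\theta,z):z\in\mathcal{Z}\}$. The nuisance tangent set $T^0_N(\theta,z)$ is the set of $\nu\in L^2_0(P_{\theta z})$ for which there are a set $V\subseteq[0,\infty)$ containing $0$ and having $0$ as an accumulation point, a path $\{p_t\}_{t\in V}\subseteq\mathcal{P}^*_\theta$ and functions $\{r_t\}_{t\in V}\subseteq L^2(P_{\theta z})$ with $p_t=p+tp\nu+tpr_t$ for all $t\in V$, where $p=p(\cdot;\theta,z)$, and $\|r_t\|_{L^2(P_{\theta z})}\to0$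 as $t\downarrow0$. $T_N(\theta,z)$ is the $L^2_0(P_{\theta z})$-closure of the linear span of $T_N^0(\theta,z)$, and $T_N^\perp(\theta,z)$ is its orthogonal complement in $L^2_0(P_{\theta z})$. The space $F_{IA}$. For $z,z_*\in\mathcal{Z}$, the $m$-parallel transport of $a\in L^2_0(P_{\theta z_*})$ from $z_*$ to $z$ is $\overset{(m)}{\Pi}{}_{z_*}^{z}a=\frac{p(\cdot;\theta,z_* )}{p(\cdot;\theta,z)}\,a$. Define $F_{IA}(\theta,z)=\{r\in T_N^\perp(\theta,z):\ \langle\overset{(m)}{\Pi}{}_{z_*}^{z}\nu_*,r\rangle_{\theta z}=0\ \text{for all } z_*\in\mathcal{Z},\ \nu_*\in T_N(\theta,z_* )\}$ (it is understood that the transported functions lie in $L^2(P_{\theta z})$, so that the inner products are defined).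
   Formalization: The inclusion of the intersection in F_IA is proved as stated; the equality is proved under the added (necessary) assumption that every element of F_IA(θ,z) lies in L²_0(P_{θz*}) for all z*, without which it can fail. *)

(* Defs.v *)
From HB Require Import structures.
From mathcomp Require Import all_boot all_order all_algebra.
From mathcomp Require Import all_classical all_reals all_analysis.

Set Implicit Arguments.
Unset Strict Implicit.
Unset Printing Implicit Defensive.

Import Order.TTheory GRing.Theory Num.Theory.
Import numFieldNormedType.Exports.

Local Open Scope classical_set_scope.
Local Open Scope ring_scope.

Section L2.
Context {d : measure_display} {X : measurableType d} {R : realType}.
Implicit Types (P : probability X R) (S : set (X -> R)).

(* Elements of L^2 are represented by functions rather than by classes of
   functions modulo almost everywhere equality; every set of functions built
   below is saturated for that equivalence. *)
Definition L2 P : set (X -> R) := [set f | f \in Lfun P 2%:E].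

Definition L20 P : set (X -> R) := [set f | L2 P f /\ ('E_P[f] = 0)%E].

Definition L2norm P (f : X -> R) : \bar R := 'N[P]_2%:E[EFin \o f]%E.

Definition inner P (f g : X -> R) : R := \int[P]_x (f x * g x).

Definition lin_span S : set (X -> R) :=
  [set f | exists (n : nat) (c : 'I_n -> R) (g : 'I_n -> X -> R),
     (forall i, S (g i)) /\ f = \sum_(i < n) c i *: g i].

Definition L20_closure P S : set (X -> R) :=
  [set f | L20 P f /\ forall e : R, 0 < e ->
     exists2 g, S g & (L2norm P (f - g)%R < e%:E)%E].

Definition L20_orth P S : set (X -> R) :=
  [set r | L20 P r /\ forall nu, S nu -> inner P nu r = 0].

End L2.

(* The probabilities and densities are total functions of theta, but they are
   only constrained for theta in Theta. *)
Record model (d : measure_display) (X : measurableType d) (R : realType)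
    (lambda : {sigma_finite_measure set X -> \bar R}) (q : nat) (Z : Type) := {
  Theta : set 'rV[R]_q ;
  Pr : 'rV[R]_q -> Z -> probability X R ;
  dens : 'rV[R]_q -> Z -> X -> R ;
  Theta_open : open Theta ;
  dens_measurable : forall theta z, Theta theta ->
    measurable_fun setT (dens theta z) ;
  dens_gt0 : forall theta z, Theta theta -> forall x, 0 < dens theta z x ;
  (* dens theta z is the Radon-Nikodym derivative d(Pr theta z)/d(lambda) *)
  Pr_dens : forall theta z, Theta theta -> forall A, measurable A ->
    Pr theta z A = (\int[lambda]_(x in A) (dens theta z x)%:E)%E ;
  (* densities are identified when they agree lambda-almost everywhere *)
  dens_inj : forall theta1 theta2 z1 z2, Theta theta1 -> Theta theta2 ->
    {ae lambda, forall x, dens theta1 z1 x = dens theta2 z2 x} ->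
    theta1 = theta2 /\ z1 = z2
}.

Section Nuisance.
Context {d : measure_display} {X : measurableType d} {R : realType}
  {lambda : {sigma_finite_measure set X -> \bar R}} {q : nat} {Z : Type}.
Variable M : model lambda q Z.
Implicit Types (theta : 'rV[R]_q) (z : Z).

Definition Pstar theta : set (X -> R) := range (dens M theta).

(* The families path and r are only used on V; the remainder r is taken along
   the filter of positive t in V tending to 0. *)
Definition TN0 theta z : set (X -> R) :=
  [set nu | L20 (Pr M theta z) nu /\
     exists (V : set R) (path r : R -> X -> R),
       [/\ V `<=` [set t | 0 <= t], V 0 & limit_point V 0] /\
       [/\ forall t, V t -> Pstar theta (path t),
           forall t, V t -> L2 (Pr M theta z) (r t),
           forall t, V t -> {ae lambda, forall x,
             path t x = dens M theta z x + t * dens M theta z x * nu x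
                        + t * dens M theta z x * r t x} &
           (L2norm (Pr M theta z) (r t) @[t --> within V 0^'+] --> 0)%E]].

Definition TN theta z : set (X -> R) :=
  L20_closure (Pr M theta z) (lin_span (TN0 theta z)).

Definition TNperp theta z : set (X -> R) :=
  L20_orth (Pr M theta z) (TN theta z).

Definition mtransport theta (zs z : Z) (a : X -> R) : X -> R :=
  fun x => dens M theta zs x / dens M theta z x * a x.

Definition FIA theta z : set (X -> R) :=
  [set r | TNperp theta z r /\
     forall (zs : Z) (nus : X -> R), TN theta zs nus ->
       inner (Pr M theta z) (mtransport theta zs z nus) r = 0].

End Nuisance.

(* Main.v *)
Require Import Defs.
From mathcomp Require Import all_boot all_order all_algebra.
From mathcomp Require Import all_classical all_reals all_analysis.
From mathcomp Require Import measurable_realfun ring.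

Local Open Scope classical_set_scope.
Local Open Scope ring_scope.

Import Order.TTheory GRing.Theory Num.Theory.

(** Written against [lambda], the density at [z] cancels from the inner product of a transported
    function with [r], leaving the inner product of the original function with [r] under
    [Pr M theta zs] ([inner_mtransport]). Both sides of the theorem thus impose the same
    orthogonality conditions and can differ only in the ambient spaces L^2_0. *)

Section density_change_of_variables.
Context (d : measure_display) (X : measurableType d) (R : realType).
Context (lambda : {sigma_finite_measure set X -> \bar R}) (P : probability X R).
Context (p : X -> R).
Hypothesis mp : measurable_fun setT p.
Hypothesis p_ge0 : forall x, 0 <= p x.
Hypothesis Pp : forall A, measurable A ->
  P A = (\int[lambda]_(x in A) (p x)%:E)%E.

Lemma density_null_dominates : P `<< lambda.
Proof.
apply/null_content_dominatesP => A mA lA0; rewrite Pp//.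
apply: null_set_integral => //.
by apply/measurable_EFinP; apply: measurable_funTS.
Qed.

Lemma ge0_integral_density (f : X -> \bar R) :
    (forall x, 0 <= f x)%E -> measurable_fun setT f ->
  (\int[P]_x f x = \int[lambda]_x (f x * (p x)%:E))%E.
Proof.
move=> f0 mf; have Pl := density_null_dominates.
have RNint := Radon_Nikodym_SigmaFinite.f_integrable Pl.
have mEp : measurable_fun setT (EFin \o p) by apply/measurable_EFinP.
rewrite -(Radon_Nikodym_SigmaFinite.change_of_variables Pl)//.
apply: ge0_ae_eq_integral => //.
- by apply: emeasurable_funM => //; exact: measurable_int RNint.
- exact: emeasurable_funM.
- by move=> x _; rewrite mule_ge0// Radon_Nikodym_SigmaFinite.f_ge0.
- by move=> x _; rewrite mule_ge0// lee_fin.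
(* The Radon-Nikodym derivative of [P] equals [p] almost everywhere, having the same integral over
   every measurable set. *)
- apply: (ae_eq_comp2 (fun x y => f x * y)%E).
  apply: (@integral_ae_eq _ _ _ _ _ measurableT) => // A _ mA.
  by rewrite -Radon_Nikodym_SigmaFinite.f_integral// -Pp.
Qed.

(** Multiplication by [p >= 0] commutes with positive and negative parts, so the nonnegative case
    applies to each, whether or not [f] is integrable. *)
Lemma integral_density (f : X -> R) : measurable_fun setT f ->
  (\int[P]_x (f x)%:E = \int[lambda]_x (f x * p x)%:E)%E.
Proof.
move=> mf; have mEf : measurable_fun setT (EFin \o f) by apply/measurable_EFinP.
rewrite integralE [RHS]integralE.
rewrite !ge0_integral_density//; last 2 first.
- exact: measurable_funeneg.
- exact: measurable_funepos.
congr (_ - _)%E; apply: eq_integral => x _.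
- by rewrite !funeposE -EFin_max -EFinM maxr_pMl// mul0r -EFin_max.
- by rewrite !funenegE -!EFinN -EFin_max -EFinM maxr_pMl// mul0r mulNr -EFin_max.
Qed.

End density_change_of_variables.

Lemma measurable_fun_L2 (d : measure_display) (X : measurableType d)
    (R : realType) (P : probability X R) (f : X -> R) :
  L2 P f -> measurable_fun setT f.
Proof. by move=> /sub_Lfun_mfun; rewrite inE. Qed.

(* Both sides are the integral of [dens theta zs * nu * r] against [lambda],
   which does not involve [z]. *)
Lemma inner_mtransport (R : realType) (d : measure_display)
    (X : measurableType d) (lambda : {sigma_finite_measure set X -> \bar R})
    (q : nat) (Z : Type) (M : model lambda q Z) (theta : 'rV[R]_q)
    (zs z : Z) (nu r : X -> R) :
    Theta M theta -> measurable_fun setT nu -> measurable_fun setT r ->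
  inner (Pr M theta z) (mtransport M theta zs z nu) r =
  inner (Pr M theta zs) nu r.
Proof.
move=> htheta mnu mr; rewrite /inner /Rintegral; congr fine.
have mdens z' := @dens_measurable _ _ _ _ _ _ M theta z' htheta.
have dens0 z' x := @dens_gt0 _ _ _ _ _ _ M theta z' htheta x.
have integral_Pr z' (f : X -> R) : measurable_fun setT f ->
    (\int[Pr M theta z']_x (f x)%:E =
     \int[lambda]_x (f x * dens M theta z' x)%:E)%E.
  move=> mf; apply: (@integral_density _ _ _ lambda) => // [x|A mA].
    exact: ltW.
  exact: Pr_dens.
rewrite !integral_Pr//; last 2 first.
- exact: measurable_funM.
- apply: measurable_funM => //; apply: measurable_funM => //.
  apply: measurable_funM => //.
  (* The reciprocal of a positive density is its power -1, which is measurable. *)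
  under eq_fun do rewrite -powR_inv1 ?(ltW (dens0 _ _))//.
  exact: (measurableT_comp (measurable_powR (-1)) (mdens z)).
apply: eq_integral => x _; congr EFin; rewrite /mtransport.
by field; rewrite gt_eqF.
Qed.

(* htransport: the transported functions lie in L^2(P_{theta z}), so that the
   inner products defining FIA theta z make sense.
   The premise of the second conjunct places FIA theta z in the ambient spaces
   L^2_0(P_{theta zs}) of the orthogonal complements; it is necessary for the
   equality and does not follow from the other hypotheses. *)
Theorem proposition14 (R : realType) (d : measure_display)
    (X : measurableType d) (lambda : {sigma_finite_measure set X -> \bar R})
    (q : nat) (Z : Type) (M : model lambda q Z)
    (theta : 'rV[R]_q) (z : Z) (htheta : Theta M theta)
    (htransport : forall (zs : Z) (nus : X -> R), TN M theta zs nus ->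
       L2 (Pr M theta z) (mtransport M theta zs z nus)) :
  \bigcap_(zs in [set: Z]) TNperp M theta zs `<=` FIA M theta z /\
  ((forall zs : Z, FIA M theta z `<=` L20 (Pr M theta zs)) ->
   FIA M theta z = \bigcap_(zs in [set: Z]) TNperp M theta zs).
Proof.
have mTN zs nu : TN M theta zs nu -> measurable_fun setT nu.
  by move=> [[/measurable_fun_L2]].
have sub_FIA : \bigcap_(zs in [set: Z]) TNperp M theta zs `<=` FIA M theta z.
  (* The index [zs = z] of the intersection gives [TNperp M theta z r]. *)
  move=> r rperp; split=> [|zs nu nuT]; first exact: rperp.
  have [[/measurable_fun_L2 mr _] r_orth] := rperp zs I.
  by rewrite inner_mtransport//; [exact: r_orth|exact: mTN nuT].
split=> // FIA_L20; apply/seteqP; split=> // r rF zs _.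
split=> [|nu nuT]; first exact: FIA_L20.
have [[[/measurable_fun_L2 mr _] _] r_orth] := rF.
rewrite -(@inner_mtransport _ _ _ _ _ _ M theta zs z)//; last exact: mTN nuT.
exact: r_orth.
Qed.
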